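(* Let $m\ge 0$ be an integer. Then there is a positive constant $C$ such that, for any compact $E\subset(0,1)^2\subset\mathbb{C}$, any $0<t<2$, and any $\varepsilon>0$, there is a finite collection of closed dyadic cubes $\mathcal{P}=\{P_i\}_{i=1}^N$ such that: (a) $2^mP_i\cap 2^mP_j=\emptyset$ for $i\ne j$; (b) $E\subset\bigcup_{i=1}^N 3\cdot 2^m P_i$; (c) $\|\mathcal{P}\|_{t\text{-pack}}\le 1$; (d) $\sum_{i=1}^N\ell(P_i)^t\le C\left(\mathcal{H}^t_\infty(E)+\varepsilon\right)$.
   Context: Cubes are squares in the plane with sides parallel to the axes. A closed dyadic cube is a set of the form $[2^{-k}m_1,2^{-k}(m_1+1)]\times[2^{-k}m_2,2^{-k}(m_2+1)]$ with $k$ a non-negative integer and $m_1,m_2$ integers. $\ell(Q)$ is the side-length of the cube $Q$, and for $a>0$, $aQ$ is the cube concentric with $Q$ with $\ell(aQ)=a\,\ell(Q)$. For a finite collection $\mathcal{P}$ of disjoint dyadic cubes and $0<t<2$, the $t$-Carleson packing norm is $$\|\mathcal{P}\|_{t\text{-pack}}=\sup_Q\Bigl[\ell(Q)^{-t}\sum_{P\in\mathcal{P},\,P\subset Q}\ell(P)^t\Bigr]^{1/t},$$ the supremum being over all dyadic cubes $Q$. The Hausdorff content is $\mathcal{H}^t_\infty(E)=\inf\{\sum_{i=1}^\infty\operatorname{diam}(B_i)^t: E\subset\bigcup_{i=1}^\infty B_i\}$, where the $B_i\subset\mathbb{C}$ are arbitrary sets. *)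

(* Defs.v *)
From mathcomp Require Import all_boot all_order all_algebra.
From mathcomp Require Import complex.
From mathcomp Require Import all_classical all_reals all_analysis.
Set Implicit Arguments.
Unset Strict Implicit.
Unset Printing Implicit Defensive.
Import Order.TTheory GRing.Theory Num.Theory.
Import numFieldNormedType.Exports.
Local Open Scope classical_set_scope.
Local Open Scope ring_scope.
Local Open Scope complex_scope.

(* Closed squares in the complex plane with sides parallel to the axes. *)
Record cube (R : realType) := Cube { center : R[i]; side : R }.

Definition cube_set (R : realType) (Q : cube R) : set R[i] :=
  [set z | `|complex.Re z - complex.Re (center Q)| <= side Q / 2 /\
           `|complex.Im z - complex.Im (center Q)| <= side Q / 2].

Definition dilate (R : realType) (a : R) (Q : cube R) : cube R :=
  Cube (center Q) (a * side Q).

Definition dyadic_cube (R : realType) (k : nat) (m1 m2 : int) : cube R :=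
  Cube ((2 ^- k * (m1%:~R + 2^-1)) +i* (2 ^- k * (m2%:~R + 2^-1))) (2 ^- k).

Lemma dyadic_cubeE (R : realType) (k : nat) (m1 m2 : int) :
  cube_set (dyadic_cube R k m1 m2) =
  [set z | 2 ^- k * m1%:~R <= complex.Re z <= 2 ^- k * (m1 + 1)%:~R /\
           2 ^- k * m2%:~R <= complex.Im z <= 2 ^- k * (m2 + 1)%:~R].
Proof.
have half : (2^-1 + 2^-1 : R) = 1 by rewrite [RHS]splitr !mul1r.
have E (c x : R) (m : int) : (`|x - c * (m%:~R + 2^-1)| <= c / 2) =
    (c * m%:~R <= x <= c * (m + 1)%:~R).
  by rewrite ler_distl -mulrBr -mulrDr addrK -addrA half intrD.
by apply/seteqP; split => z; rewrite /cube_set /= !E.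
Qed.

Definition dyadic (R : realType) : set (cube R) :=
  [set Q | exists k m1 m2, Q = dyadic_cube R k m1 m2].

Definition pack_norm (R : realType) (t : R) (N : nat) (P : 'I_N -> cube R) :
    \bar R :=
  ereal_sup [set ((side Q `^ (- t) *
     \sum_(i < N | `[< cube_set (P i) `<=` cube_set Q >]) side (P i) `^ t)
       `^ t^-1)%:E | Q in @dyadic R].

(* The point 0 only matters for B = set0, where it makes the diameter 0. *)
Definition diam (R : realType) (B : set R[i]) : \bar R :=
  ereal_sup (0%E |` [set (complex.Re `|z - w|)%:E | z in B & w in B]).

Definition hausdorff_content (R : realType) (t : R) (E : set R[i]) : \bar R :=
  ereal_inf [set (\sum_(0 <= i <oo) (diam (B i) `^ t))%E |
    B in [set B : (set R[i])^nat | E `<=` \bigcup_i B i]].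

(* Main.v *)
Require Import Defs.
From mathcomp Require Import all_boot all_order all_algebra.
From mathcomp Require Import complex.
From mathcomp Require Import all_classical all_reals all_analysis.
From mathcomp Require Import ring lra zify.
Import Order.TTheory GRing.Theory Num.Theory.
Import numFieldNormedType.Exports.
Local Open Scope classical_set_scope.
Local Open Scope ring_scope.
Local Open Scope complex_scope.

(** Write H for the content of E and w(D) = side(D)^t.

    By the definition of H and by compactness, E is covered by finitely many
    balls whose radii e satisfy sum e^t <= H + 2 eps ([ball_cover]): every set
    of a nearly optimal cover is enlarged to an open ball centred at one of its
    points in E, the extra cost being spread geometrically.  The part in the
    unit square of a ball of radius e lies in the nine dyadic cubes of side
    2^-k around its centre, where 2^-k is at most 2e; since t < 2, these cost
    at most 9 * 4 * e^t ([dyadic_cover]).  So E is covered by finitely many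
    dyadic cubes whose total weight is at most 36 (H + 2 eps), with a constant
    independent of t.

    It remains to achieve packing and separation.  If some dyadic cube Q is
    overfull, that is, if the cubes of the family inside Q weigh more than Q,
    they are all replaced by the single cube Q.  This lowers the total weight
    and still covers.  It also shortens the family, because one cube alone
    cannot overfill a cube containing it.  So the process stops, and then the
    family satisfies the packing condition ([packed_domination]).  Finally a
    Vitali selection by decreasing size ([greedy_selection]) keeps a subfamily
    with disjoint 2^m-dilates; a rejected cube D has its 2^m-dilate meeting the
    2^m-dilate of a selected cube Q at least as large, so 3 * 2^m Q contains D.
    Passing to a subfamily can only decrease the sums, so the packing condition
    survives.  Hence C = 72 serves for every m. *)

(** * Greedy selection *)

(** When the sequence is scanned from left to right, an element is kept exactly
    if it conflicts with no element kept before; the ordering hypothesis then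
    says that whatever rejects it precedes it for [le].  Reflexivity of [r] and
    [le] lets the kept elements be dominated by themselves. *)
Lemma greedy_selection (T : eqType) (r le : rel T) (s : seq T) :
  reflexive r -> reflexive le -> pairwise le s ->
  exists s', [/\ subseq s' s, pairwise (fun x y => ~~ r x y) s' &
    forall x, x \in s -> exists2 y, y \in s' & le y x && r y x].
Proof.
move=> rr lr; elim/last_ind: s => [|s x IH] ; first by exists [::].
rewrite pairwise_rcons => /andP[/allP lex /IH[s' [sub dis dom]]].
have [/hasP[y ys' ryx]|] := boolP (has (r^~ x) s').
  exists s'; split => // [|z]; first exact: subseq_trans (subseq_rcons _ _).
  rewrite mem_rcons inE => /predU1P[->|]; last exact: dom.
  by exists y => //; rewrite ryx andbT; apply/lex/(mem_subseq sub).
rewrite -all_predC => far; exists (rcons s' x); split => [||z].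
- by rewrite -!cats1 cat_subseq.
- by rewrite pairwise_rcons far.
rewrite mem_rcons inE => /predU1P[->|/dom[y ys' yz]].
  by exists x; rewrite ?mem_rcons ?mem_head// rr lr.
by exists y => //; rewrite mem_rcons inE ys' orbT.
Qed.

(** * Families of dyadic cubes and packing *)

Section DyadicFamilies.
Set Implicit Arguments.
Unset Strict Implicit.
Variable R : realType.
Implicit Types (t a : R) (D Q : nat * int * int) (s : seq (nat * int * int)).

(** Families of cubes are lists of indices, which have a decidable equality that
    real cubes lack; nothing prevents repetitions. *)
Definition dyadic_at D : cube R := dyadic_cube R D.1.1 D.1.2 D.2.

Definition weight t D : R := side (dyadic_at D) `^ t.

Definition inside Q D : bool :=
  `[< cube_set (dyadic_at D) `<=` cube_set (dyadic_at Q) >].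

Definition meet a D D' : bool :=
  `[< cube_set (dilate a (dyadic_at D)) `&` cube_set (dilate a (dyadic_at D'))
      !=set0 >].

(** This is the bound by 1 on the packing norm, with the roots and quotients
    cleared. *)
Definition packed t s :=
  forall Q, \sum_(D <- s | inside Q D) weight t D <= weight t Q.

Lemma weight_ge0 t D : 0 <= weight t D.
Proof. exact: powR_ge0. Qed.

Lemma side_gt0 D : 0 < side (dyadic_at D).
Proof. by rewrite /= invr_gt0 exprn_gt0. Qed.

Lemma center_in_cube (Q : cube R) : 0 <= side Q -> cube_set Q (Defs.center Q).
Proof. by move=> h; rewrite /cube_set /= !subrr normr0; split; lra. Qed.

(** The midpoints of the left and right sides of P both lie in Q, and they are
    at distance [side P]. *)
Lemma cube_set_le_side (P Q : cube R) :
  0 <= side P -> cube_set P `<=` cube_set Q -> side P <= side Q.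
Proof.
move=> s0 PQ.
have h : 0 <= side P / 2 by lra.
have [|/= hl _] := PQ ((complex.Re (Defs.center P) + side P / 2) +i* complex.Im (Defs.center P)).
  by rewrite /cube_set /= subrr normr0 addrAC subrr add0r ger0_norm.
have [|/= hr _] := PQ ((complex.Re (Defs.center P) - side P / 2) +i* complex.Im (Defs.center P)).
  by rewrite /cube_set /= subrr normr0 addrAC subrr add0r normrN ger0_norm.
by move: hl hr; rewrite !ler_norml => /andP[_ a1] /andP[a2 _]; lra.
Qed.

Lemma weight_inside t Q D : 0 <= t -> inside Q D -> weight t D <= weight t Q.
Proof.
have s0 E : 0 <= side (dyadic_at E) by apply/ltW/side_gt0.
move=> t0 /asboolP /(cube_set_le_side (s0 D)).
by apply: ge0_ler_powR; rewrite ?nnegrE.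
Qed.

(** An overfull cube replaces all the cubes inside it, which lowers the total
    weight.  At least two cubes disappear, since a cube weighs no more than a
    cube containing it; so the length of the list decreases. *)
Lemma packed_domination t s : 0 <= t ->
  exists s', [/\ packed t s',
    \sum_(D <- s') weight t D <= \sum_(D <- s) weight t D &
    forall D, D \in s -> exists2 Q, Q \in s' & inside Q D].
Proof.
move=> t0; have [n] := ubnP (size s); elim: n s => // n IH s sn.
have [ps|/existsNP[Q /negP]] := pselect (packed t s).
  by exists s; split=> // D Ds; exists D => //; apply/asboolP.
rewrite -ltNge => overfull.
pose s1 := Q :: [seq D <- s | ~~ inside Q D].
have two : (1 < count (inside Q) s)%N.
  rewrite -size_filter ltnNge; apply/negP => le1.
  move: overfull; rewrite -big_filter.
  have : all (inside Q) [seq D <- s | inside Q D] by apply: filter_all.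
  case: [seq D <- s | inside Q D] le1 => [|D [|//]] _ /=.
    by rewrite big_nil ltNge weight_ge0.
  by rewrite andbT big_seq1 => /(weight_inside t0) le; rewrite ltNge le.
have [|s' [ps' ws' cs']] := IH s1.
  rewrite /= size_filter -[X in (X.+1 < n)%N]/(count (predC (inside Q)) s).
  by have := count_predC (inside Q) s; lia.
exists s'; split => // [|D Ds].
  apply: (le_trans ws'); rewrite big_cons big_filter.
  by rewrite [leRHS](bigID (inside Q)) lerD2r ltW.
have [DQ|DQ] := boolP (inside Q D).
  have [Q' Q's' QQ'] := cs' Q (mem_head _ _).
  exists Q' => //; apply/asboolP; apply: subset_trans (asboolP _ QQ').
  exact/asboolP.
by apply: cs'; rewrite inE mem_filter DQ Ds orbT.
Qed.

Lemma sum_weight_subseq t (p : pred (nat * int * int)) s s' : subseq s' s ->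
  \sum_(D <- s' | p D) weight t D <= \sum_(D <- s | p D) weight t D.
Proof.
move=> /perm_to_subseq[s2 ss].
by rewrite (perm_big _ ss) big_cat lerDl sumr_ge0 // => D _; apply: weight_ge0.
Qed.

Lemma packed_subseq t s s' : subseq s' s -> packed t s -> packed t s'.
Proof. by move=> ss ps Q; apply: le_trans (ps Q); apply: sum_weight_subseq. Qed.

Lemma packed_perm t s s' : perm_eq s s' -> packed t s -> packed t s'.
Proof. by move=> ss ps Q; rewrite -(perm_big _ ss) /=. Qed.

Lemma meet_refl a : 0 <= a -> reflexive (meet a).
Proof.
move=> a0 D; apply/asboolP; rewrite setIid.
by exists (Defs.center (dyadic_at D)); apply: (@center_in_cube (dilate a _));
  rewrite mulr_ge0 // ltW ?side_gt0.
Qed.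

Lemma dilate_subset (a b : R) (Q : cube R) : 0 <= side Q -> a <= b ->
  cube_set (dilate a Q) `<=` cube_set (dilate b Q).
Proof.
move=> s0 ab z; rewrite /cube_set /= => -[h1 h2].
have : a * side Q / 2 <= b * side Q / 2 by rewrite ler_pM2r // ler_wpM2r.
by split; lra.
Qed.

(** The Vitali inclusion: if the dilates of D and D' meet, a point of the dilate
    of D' is within [a side(D')], hence within [a side(D)], of the dilate of D. *)
Lemma meet_subset a D D' : 0 <= a -> (D.1.1 <= D'.1.1)%N -> meet a D D' ->
  cube_set (dilate a (dyadic_at D')) `<=` cube_set (dilate (3 * a) (dyadic_at D)).
Proof.
move=> a0 kk /asboolP[w [[/= u1 u2] [/= v1 v2]]] z [/= z1 z2].
have : a * 2 ^- D'.1.1 <= a * 2 ^- D.1.1 :> R.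
  by rewrite ler_wpM2l // lef_pV2 ?posrE ?exprn_gt0 // ler_weXn2l // ler1n.
rewrite /cube_set /= -(mulrA 3 a).
move: (a * _) (a * _) (2 ^- _ * _) (2 ^- _ * _) (2 ^- _ * _) (2 ^- _ * _)
  u1 u2 v1 v2 z1 z2 => sD' sD c1 c2 c1' c2'.
rewrite !ler_norml => /andP[? ?] /andP[? ?] /andP[? ?] /andP[? ?]
  /andP[? ?] /andP[? ?] ?.
by split; apply/andP; split; lra.
Qed.

(** Packing comes before separation: replacing cubes by larger ones may create
    new conflicts, whereas a subfamily of a packed family is packed. *)
Lemma separated_packing t a s : 0 <= t -> 1 <= a ->
  exists s', [/\ packed t s', pairwise (fun D D' => ~~ meet a D D') s',
    \sum_(D <- s') weight t D <= \sum_(D <- s) weight t D &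
    forall D, D \in s -> exists2 Q, Q \in s' &
      cube_set (dyadic_at D) `<=` cube_set (dilate (3 * a) (dyadic_at Q))].
Proof.
move=> t0 a1; have a0 : 0 <= a by lra.
have [s1 [p1 w1 c1]] := packed_domination s t0.
(* a smaller generation means a larger cube *)
pose le D D' := (D.1.1 <= D'.1.1)%N.
have letr : transitive le by move=> x y z; apply: leq_trans.
have letot : total le by move=> x y; apply: leq_total.
have [||s' [sub dis dom]] := greedy_selection _ (meet a) le (sort le s1) (meet_refl a0).
- by move=> D; apply: leqnn.
- by rewrite -sorted_pairwise //; apply: sort_sorted.
have ps : perm_eq s1 (sort le s1) by rewrite perm_sym perm_sort.
exists s'; split => //.
- exact/(packed_subseq sub)/(packed_perm ps).
- apply: le_trans w1; rewrite (perm_big _ ps) /=; exact: sum_weight_subseq.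
- move=> D /c1[D1 D1s /asboolP DD1].
  have [|Q Qs' /andP[QD1 mt]] := dom D1; first by rewrite mem_sort.
  exists Q => //; apply: subset_trans DD1 _.
  apply: subset_trans (meet_subset a0 QD1 mt).
  rewrite -[X in cube_set X `<=` _](_ : dilate 1 (dyadic_at D1) = _).
    by apply: dilate_subset => //; rewrite ltW // side_gt0.
  by rewrite /dilate mul1r.
Qed.

Lemma pack_norm_le1 t s : 0 < t -> packed t s ->
  (pack_norm t (fun i : 'I_(size s) => dyadic_at (nth (0%N, 0%R, 0%R) s i)) <= 1)%E.
Proof.
move=> t0 ps; apply: ge_ereal_sup => _ [_ [k [m1 [m2 ->]]] <-].
have := ps (k, m1, m2); rewrite (big_nth (0%N, 0, 0)) big_mkord.
rewrite /weight /inside /dyadic_at /= => le; rewrite lee_fin.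
set c := 2 ^- k in le *.
have c0 : 0 < c `^ t by rewrite powR_gt0 // invr_gt0 exprn_gt0.
rewrite -[leRHS](_ : 1 `^ t^-1 = 1); last by rewrite powR1.
apply: ge0_ler_powR.
- by rewrite invr_ge0 ltW.
- by rewrite nnegrE mulr_ge0 ?powR_ge0 // sumr_ge0 // => i _; apply: powR_ge0.
- by rewrite nnegrE.
- by rewrite powRN mulrC ler_pdivrMr // mul1r.
Qed.

End DyadicFamilies.

(** * Covering balls by dyadic cubes *)

Section NineCubes.
Set Implicit Arguments.
Unset Strict Implicit.
Variable R : realType.

Definition unit_square : set R[i] :=
  [set z | 0 < complex.Re z < 1 /\ 0 < complex.Im z < 1].

(** Dyadic cubes have side at most 1, so for e > 1 no scale reaches e; the
    largest one, k = 0, is then the choice. *)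
Lemma dyadic_scale (e : R) : 0 < e ->
  exists k, (e <= 2 ^- k \/ k = 0%N) /\ 2 ^- k <= 2 * e.
Proof.
move=> e0.
have ex : exists n, 2 ^- n <= e.
  exists (Num.trunc e^-1).+1; rewrite invf_ple ?posrE ?exprn_gt0 //.
  apply: ltW; apply: lt_le_trans (truncnS_gt _) _.
  by rewrite -natrX ler_nat ltnW // ltn_expl.
case: (ex_minnP ex) => -[|k] le_e min_k.
  by exists 0%N; split; [right|lra].
exists k; split.
  by left; rewrite leNgt; apply/negP => /ltW /min_k; rewrite ltnn.
by rewrite -ler_pdivrMl // -invfM -exprS.
Qed.

Lemma unit_square_dist (z w : R[i]) : unit_square z -> unit_square w ->
  `|complex.Re z - complex.Re w| <= 1 /\ `|complex.Im z - complex.Im w| <= 1.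
Proof.
move=> [/andP[? ?] /andP[? ?]] [/andP[? ?] /andP[? ?]].
by rewrite !ler_norml; split; apply/andP; split; lra.
Qed.

Definition cell (k : nat) (x : R) : int := Num.floor (x * 2 ^+ k).

Lemma cell_itv k x : 2 ^- k * (cell k x)%:~R <= x <= 2 ^- k * (cell k x + 1)%:~R.
Proof.
have /andP[h1 h2] := floor_itv (x * 2 ^+ k).
have k0 : 0 < 2 ^+ k :> R by rewrite exprn_gt0.
by rewrite -!(mulrC _%:~R) ler_pdivrMr // h1 ler_pdivlMr // ltW.
Qed.

(** The closed inequality suffices because cells are half-open: the cell at
    distance two to the right starts strictly beyond [y + 2^-k]. *)
Lemma cell_near k x y : `|x - y| <= 2 ^- k ->
  cell k x \in [:: cell k y - 1; cell k y; cell k y + 1].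
Proof.
have k0 : 0 < 2 ^+ k :> R by rewrite exprn_gt0.
rewrite -(ler_pM2r k0) mulVf ?gt_eqF // -{1}(gtr0_norm k0) -normrM mulrBl.
have /andP := floor_itv (x * 2 ^+ k); have /andP := floor_itv (y * 2 ^+ k).
rewrite -!/(cell _ _) !intrD !mulr1z => -[y1 y2] [x1 x2]; rewrite ler_norml => /andP[d1 d2].
have a1 : (cell k y < cell k x + 2)%R by rewrite -(ltr_int R) intrD; lra.
have a2 : (cell k x < cell k y + 2)%R by rewrite -(ltr_int R) intrD; lra.
by rewrite !inE; lia.
Qed.

Definition nine_cubes (k : nat) (x : R[i]) : seq (nat * int * int) :=
  let near c := [:: cell k c - 1; cell k c; cell k c + 1] in
  [seq (k, i, j) | i <- near (complex.Re x), j <- near (complex.Im x)].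

Lemma nine_cubes_cover k x z :
  `|complex.Re z - complex.Re x| <= 2 ^- k ->
  `|complex.Im z - complex.Im x| <= 2 ^- k ->
  exists2 D, D \in nine_cubes k x & cube_set (dyadic_at R D) z.
Proof.
move=> /cell_near zi /cell_near zj.
exists (k, cell k (complex.Re z), cell k (complex.Im z)).
  by apply/allpairsP; exists (cell k (complex.Re z), cell k (complex.Im z)).
by rewrite dyadic_cubeE /=; split; apply: cell_itv.
Qed.

Lemma weight_nine_cubes (t : R) k x :
  \sum_(D <- nine_cubes k x) weight t D = 9 * (2 ^- k) `^ t.
Proof.
by rewrite /nine_cubes !(big_cons, big_nil) /weight /=; ring.
Qed.

(** When the radius exceeds the side 1 of the chosen cubes, the estimate uses
    that both points lie in the unit square instead of the radius.  The constant
    is 36 = 9 * 2^2, where 2^2 bounds (2e)^t / e^t. *)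
Lemma dyadic_cover (t : R) (s : seq (R[i] * R)) : 0 < t < 2 ->
  (forall p, p \in s -> unit_square p.1 /\ 0 < p.2) ->
  exists F : seq (nat * int * int),
    (forall z p, p \in s -> unit_square z ->
       `|complex.Re z - complex.Re p.1| <= p.2 ->
       `|complex.Im z - complex.Im p.1| <= p.2 ->
       exists2 D, D \in F & cube_set (dyadic_at R D) z) /\
    \sum_(D <- F) weight t D <= 36 * \sum_(p <- s) p.2 `^ t.
Proof.
move=> /andP[t0 t2]; elim: s => [|p s IH] sP.
  by exists [::]; split => //; rewrite !big_nil mulr0.
have [|F [cF wF]] := IH; first by move=> q qs; apply: sP; rewrite inE qs orbT.
have [up p0] := sP p (mem_head _ _).
have [k [ek ke]] := dyadic_scale p0.
exists (nine_cubes k p.1 ++ F); split.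
  move=> z q; rewrite inE => /predU1P[->|qs] uz zr zi; last first.
    by have [D DF Dz] := cF z q qs uz zr zi; exists D; rewrite ?mem_cat ?DF ?orbT.
  have [zr' zi'] : `|complex.Re z - complex.Re p.1| <= 2 ^- k /\
      `|complex.Im z - complex.Im p.1| <= 2 ^- k.
    case: ek => [ek|->]; first by split; apply: le_trans ek.
    by rewrite expr0 invr1; apply: unit_square_dist.
  have [D DF Dz] := nine_cubes_cover zr' zi'.
  by exists D => //; rewrite mem_cat; apply/orP; left.
rewrite big_cat [in leRHS]big_cons mulrDr weight_nine_cubes lerD //.
have -> : 36 * p.2 `^ t = 9 * (4 * p.2 `^ t) by ring.
rewrite ler_pM2l //.
apply: (@le_trans _ _ ((2 * p.2) `^ t)).
  apply: ge0_ler_powR; rewrite ?nnegrE //; first exact: ltW.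
  by rewrite mulr_ge0 // ltW.
rewrite powRM //; last exact: ltW.
rewrite ler_wpM2r ?powR_ge0 //.
have -> : 4 = 2 `^ 2%:R :> R by rewrite powR_mulrn // -natrX.
by rewrite ler_powR ?ler1n // ltW.
Qed.

(** The dilation factor does not enter the constant: the separation step only
    discards cubes, and the coverage lost is recovered by the dilation by 3a. *)
Lemma packing_of_cover (t a : R) (E : set R[i]) (s : seq (R[i] * R)) :
  0 < t < 2 -> 1 <= a -> E `<=` unit_square ->
  (forall p, p \in s -> unit_square p.1 /\ 0 < p.2) ->
  (forall z, E z -> exists2 p, p \in s &
     `|complex.Re z - complex.Re p.1| <= p.2 /\
     `|complex.Im z - complex.Im p.1| <= p.2) ->
  exists (N : nat) (P : 'I_N -> cube R),
    (forall i, dyadic (P i)) /\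
    (forall i j, i != j ->
       cube_set (dilate a (P i)) `&` cube_set (dilate a (P j)) = set0) /\
    E `<=` \bigcup_i cube_set (dilate (3 * a) (P i)) /\
    (pack_norm t P <= 1)%E /\
    \sum_(i < N) side (P i) `^ t <= 36 * \sum_(p <- s) p.2 `^ t.
Proof.
move=> t02 a1 Eu sP Es; have /andP[t0 _] := t02.
have [F [cF wF]] := dyadic_cover t02 sP.
have [G [pG dG wG cG]] := separated_packing F (ltW t0) a1.
exists (size G), (fun i => dyadic_at R (nth (0%N, 0, 0) G i)); split.
  by move=> i; do 3!eexists.
split.
  move=> i j; wlog ij : i j / (i < j)%N.
    move=> W ij; have [lt|] := ltnP i j; first exact: W.
    rewrite leq_eqVlt => /predU1P[/val_inj ji|lt].
      by rewrite ji eqxx in ij.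
    by rewrite setIC W // eq_sym.
  move=> _; have /(pairwiseP (0%N, 0, 0)) /(_ i j) := dG.
  move=> /(_ (ltn_ord i) (ltn_ord j) ij) /asboolPn.
  by move=> /set0P/negP/negPn/eqP.
split.
  move=> z Ez; have [p ps [zr zi]] := Es z Ez.
  have [D DF Dz] := cF z p ps (Eu z Ez) zr zi.
  have [Q QG] := cG D DF; have Qi := QG; rewrite -index_mem in Qi.
  by move=> /(_ z Dz); exists (Ordinal Qi) => //=; rewrite nth_index.
split; first exact: pack_norm_le1.
apply: le_trans wF; apply: le_trans wG.
by rewrite [leRHS](big_nth (0%N, 0, 0)) big_mkord.
Qed.

End NineCubes.

(** * From Hausdorff content to a finite cover by balls *)

Section Content.
Set Implicit Arguments.
Unset Strict Implicit.
Variable R : realType.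

Lemma diam_ge0 (B : set R[i]) : (0 <= diam B)%E.
Proof. by apply: ereal_sup_ubound; left. Qed.

Lemma le_diam (B : set R[i]) (z w : R[i]) : B z -> B w ->
  ((complex.Re `|z - w|)%:E <= diam B)%E.
Proof. by move=> Bz Bw; apply: ereal_sup_ubound; right; exists z => //; exists w. Qed.

Lemma Re_le_norm (z : R[i]) : `|complex.Re z| <= complex.Re `|z|.
Proof. by rewrite normc_def -sqrtr_sqr ler_wsqrtr // lerDl sqr_ge0. Qed.

Lemma Im_le_norm (z : R[i]) : `|complex.Im z| <= complex.Re `|z|.
Proof. by rewrite normc_def -sqrtr_sqr ler_wsqrtr // lerDr sqr_ge0. Qed.

Lemma ltc_real (z : R[i]) (e : R) : (`|z| < e%:C) = (complex.Re `|z| < e).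
Proof. by rewrite normc_def ltcR. Qed.

Lemma sum_half n : \sum_(0 <= i < n) 2 ^- i.+1 <= 1 :> R.
Proof.
suff -> : \sum_(0 <= i < n) 2 ^- i.+1 = 1 - 2 ^- n :> R.
  by rewrite gerBl invr_ge0 exprn_ge0.
elim: n => [|n IH]; first by rewrite big_geq // expr0 invr1 subrr.
rewrite big_nat_recr //= IH.
have -> : 2 ^- n = 2 * 2 ^- n.+1 :> R by rewrite exprS invfM mulrA mulfV ?mul1r.
by ring.
Qed.

Lemma hausdorff_content_ge0 (t : R) (E : set R[i]) : (0 <= hausdorff_content t E)%E.
Proof.
apply: le_ereal_inf_tmp => _ [B _ <-]; apply: nneseries_ge0 => n _ _.
exact: poweR_ge0.
Qed.

(** The radius e_i is defined by e_i^t = d_i^t + eps 2^-(i+1), where d_i is the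
    diameter of the i-th covering set.  It strictly exceeds d_i, even for d_i = 0,
    so that the open ball around any point of that set contains the set, while
    the total cost grows by at most eps. *)
Lemma ball_cover (t eps : R) (E : set R[i]) :
  compact (E : set R[i]^o) -> E `<=` @unit_square R -> 0 < t -> 0 < eps ->
  hausdorff_content t E \is a fin_num ->
  exists s : seq (R[i] * R),
    (forall p, p \in s -> @unit_square R p.1 /\ 0 < p.2) /\
    (forall z, E z -> exists2 p, p \in s &
       `|complex.Re z - complex.Re p.1| <= p.2 /\
       `|complex.Im z - complex.Im p.1| <= p.2) /\
    ((\sum_(p <- s) p.2 `^ t)%:E <= hausdorff_content t E + (2 * eps)%:E)%E.
Proof.
move=> Ec Eu t0 eps0 Hfin.
have [_ [B EB <-] sumB] := lb_ereal_inf_adherent eps0 Hfin.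
rewrite -/(hausdorff_content t E) in sumB.
have Hlt : (hausdorff_content t E + eps%:E < +oo)%E.
  by rewrite -(fineK Hfin) -EFinD ltry.
have partial n : (\sum_(0 <= i < n) diam (B i) `^ t <= hausdorff_content t E + eps%:E)%E.
  by apply: le_trans (ltW sumB); apply: nneseries_lim_ge => k _ _; apply: poweR_ge0.
have Bfin i : diam (B i) \is a fin_num.
  rewrite ge0_fin_numE ?diam_ge0 //; apply: (@lty_poweRy _ _ t); first by rewrite gt_eqF.
  apply: le_lt_trans Hlt; apply: le_trans (partial i.+1).
  rewrite big_nat_recr //= leeDr // sume_ge0 // => k _; exact: poweR_ge0.
pose d i := fine (diam (B i)).
have d0 i : 0 <= d i by rewrite fine_ge0 // diam_ge0.
pose x0 : R[i] := 2^-1 +i* 2^-1.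
(* a set that misses E gets an arbitrary centre in the unit square *)
pose x i : R[i] := xget x0 (B i `&` E).
pose e i : R := (d i `^ t + eps * 2 ^- i.+1) `^ t^-1.
have gap i : 0 < eps * 2 ^- i.+1 by rewrite mulr_gt0 // invr_gt0 exprn_gt0.
have et i : e i `^ t = d i `^ t + eps * 2 ^- i.+1.
  rewrite -powRrM mulVf ?gt_eqF // powRr1 //.
  by rewrite addr_ge0 ?powR_ge0 // ltW.
have de i : d i < e i.
  rewrite ltNge; apply/negP => ed.
  have : e i `^ t <= d i `^ t.
    by apply: ge0_ler_powR ed; rewrite ?nnegrE ?powR_ge0 // ltW.
  by rewrite et; have := gap i; lra.
have xP i : @unit_square R (x i).
  rewrite /x; case: xgetP => [y _ [_ /Eu]|_] //.
  by rewrite /unit_square /x0 /=; lra.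
have Ecov : cover_compact (E : set R[i]^o) by rewrite -compact_cover.
have [|z Ez|D _ ED] := Ecov nat setT (fun i => ball (x i : R[i]^o) ((e i)%:C)).
- by move=> i _; apply: ball_open.
- have [i _ Bz] := EB z Ez; exists i => //.
  have [Bx _] : (B i `&` E) (x i) by apply: xgetPex; exists z.
  rewrite -ball_normE /ball_ /= ltc_real; apply: le_lt_trans (de i).
  by rewrite -lee_fin fineK //; apply: le_diam.
have [n Dn] : exists n, forall i, i \in finmap.enum_fset D -> (i < n)%N.
  by exists (\max_(i <- finmap.enum_fset D) i).+1 => i iD; rewrite ltnS leq_bigmax_seq.
exists [seq (x i, e i) | i <- iota 0 n]; split.
  by move=> _ /mapP[i _ ->]; split => //=; apply: le_lt_trans (de i).
split.
  move=> z /ED[i /= iD]; rewrite -ball_normE /ball_ /= distrC ltc_real => /ltW ze.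
  exists (x i, e i).
    by apply/mapP; exists i => //; rewrite mem_iota Dn.
  by split; apply: le_trans ze; have := Re_le_norm (z - x i); have := Im_le_norm (z - x i);
    case: (z) (x i) => ? ? [].
rewrite big_map (eq_bigr (fun i => d i `^ t + eps * 2 ^- i.+1)) => [|i _ /=]; last exact: et.
rewrite -[n in iota 0 n]subn0 -/(index_iota 0 n) big_split /= -mulr_sumr.
rewrite mulr_natl mulr2n !EFinD addeA.
apply: leeD; last by rewrite lee_fin ger_pMr // sum_half.
apply: le_trans (partial n); rewrite -sumEFin lee_sum // => i _.
by rewrite -poweR_EFin fineK.
Qed.

End Content.

Theorem proposition2p2 (R : realType) (m : nat) :
  exists C : R, 0 < C /\
  forall (E : set R[i]) (t eps : R),
    compact (E : set R[i]^o) ->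
    E `<=` [set z | 0 < complex.Re z < 1 /\ 0 < complex.Im z < 1] ->
    0 < t < 2 ->
    0 < eps ->
    exists (N : nat) (P : 'I_N -> cube R),
      (forall i, dyadic (P i)) /\
      (forall i j, i != j ->
         cube_set (dilate (2 ^+ m) (P i)) `&` cube_set (dilate (2 ^+ m) (P j))
         = set0) /\
      E `<=` \bigcup_i cube_set (dilate (3 * 2 ^+ m) (P i)) /\
      (pack_norm t P <= 1)%E /\
      ((\sum_(i < N) side (P i) `^ t)%:E
         <= C%:E * (hausdorff_content t E + eps%:E))%E.
Proof.
exists 72; split => // E t eps Ec Eu t02 eps0.
have a1 : 1 <= 2 ^+ m :> R by rewrite exprn_ege1 // ler1n.
have [Hfin|Hinf] := boolP (hausdorff_content t E \is a fin_num).
  have t0 : 0 < t by case/andP: t02.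
  have [s [sP [Es ws]]] := ball_cover Ec Eu t0 eps0 Hfin.
  have [N [P [dP [aP [cP [pP wP]]]]]] := packing_of_cover t02 a1 Eu sP Es.
  exists N, P; do 4!split => //.
  move: ws; rewrite -(fineK Hfin) -!EFinD -EFinM !lee_fin => ws.
  have := fine_ge0 (hausdorff_content_ge0 t E); lra.
(* If the content is infinite, the bound is vacuous: one ball of radius 1
   around the centre covers the unit square. *)
have [||N [P [dP [aP [cP [pP wP]]]]]] :=
  @packing_of_cover R t (2 ^+ m) E [:: (2^-1 +i* 2^-1, 1)] t02 a1 Eu.
- by move=> p; rewrite inE => /eqP ->; rewrite /unit_square /=; lra.
- move=> z /Eu uz; exists (2^-1 +i* 2^-1, 1); first exact: mem_head.
  by apply: unit_square_dist => //; rewrite /unit_square /=; lra.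
exists N, P; do 4!split => //.
have := Hinf; rewrite ge0_fin_numE ?hausdorff_content_ge0 // -leNgt leye_eq => /eqP ->.
by rewrite addye // gt0_muley ?lte_fin // leey.
Qed.
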